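(* Let $X$ be a space that admits a finite good cover. Then $$\mathrm{ct}(X)\ \ge\ \tfrac12\,\mathrm{cat}(X)\,(\mathrm{cat}(X)+1).$$
   Context: An open cover $\mathcal U$ of a space $Y$ is a good cover if all elements of $\mathcal U$ and all their non-empty finite intersections are contractible. The strict covering type $\mathrm{sct}(Y)$ is the minimal cardinality of a good cover of $Y$, and the covering type of $X$ is $\mathrm{ct}(X):=\min\{\mathrm{sct}(Y)\mid Y\simeq X\}$. A subset $A\subseteq X$ is categorical if the inclusion $A\hookrightarrow X$ is homotopic to a constant map. The Lusternik–Schnirelmann category $\mathrm{cat}(X)$ is the minimal $n$ for which $X$ can be covered by $n$ open categorical subsets (so a contractible space has category $1$).
   Formalization: The space X is additionally assumed connected and normal; the inequality fails for the discrete two-point space (ct = cat = 2) and for a connected non-normal finite space that has a two-element good cover but is not contractible. *)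

(* Defs.v *)
From HB Require Import structures.
From mathcomp Require Import all_boot all_order all_algebra.
From mathcomp Require Import all_classical all_reals all_analysis.

Set Implicit Arguments.
Unset Strict Implicit.
Unset Printing Implicit Defensive.

Import Order.TTheory GRing.Theory Num.Theory.
Import numFieldNormedType.Exports.

Local Open Scope classical_set_scope.
Local Open Scope ring_scope.

Section Homotopy.
Variable R : realType. (* provides the unit interval and the values in \bar R *)

(* The maps f, g : A -> B between the subspaces A and B are homotopic.  Only the
   values of f, g and H over A matter: `{within _, continuous _}` is continuity
   for the subspace topology of [0, 1] x A. *)
Definition homotopic_within (X Y : topologicalType) (A : set X) (B : set Y)
    (f g : X -> Y) : Prop :=
  exists H : R * X -> Y,
    [/\ {within `[0, 1]%classic `*` A, continuous H},
        forall t x, t \in `[0, 1] -> A x -> B (H (t, x)),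
        forall x, A x -> H (0, x) = f x &
        forall x, A x -> H (1, x) = g x].

Definition homotopic (X Y : topologicalType) (f g : X -> Y) : Prop :=
  homotopic_within [set: X] [set: Y] f g.

Definition homotopy_equivalent (X Y : topologicalType) : Prop :=
  exists (f : X -> Y) (g : Y -> X),
    [/\ continuous f, continuous g,
        homotopic (g \o f) id & homotopic (f \o g) id].

(* A, as a subspace, is contractible (in particular nonempty). *)
Definition contractible (X : topologicalType) (A : set X) : Prop :=
  exists2 x0, A x0 & homotopic_within A A id (cst x0).

Definition categorical (X : topologicalType) (A : set X) : Prop :=
  exists x0, homotopic_within A [set: X] id (cst x0).

Definition good_cover (X : topologicalType) (U : set (set X)) : Prop :=
  [/\ forall A, U A -> open A,
      \bigcup_(A in U) A = [set: X],
      forall A, U A -> contractible A &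
      forall V : set (set X), V `<=` U -> V !=set0 -> finite_set V ->
        \bigcap_(A in V) A !=set0 -> contractible (\bigcap_(A in V) A)].

Definition has_finite_good_cover (X : topologicalType) : Prop :=
  exists2 U : set (set X), finite_set U & good_cover U.

(* Infima of sets of natural numbers (or of +oo), hence minima; the value +oo
   means that there is no finite cover of the required kind. *)
Definition sct (X : topologicalType) : \bar R :=
  ereal_inf [set n%:R%:E | n in
    [set n : nat | exists2 U : set (set X), good_cover U & (U #= `I_n)%card]].

Definition ct (X : topologicalType) : \bar R :=
  ereal_inf [set c | exists2 Y : topologicalType,
    homotopy_equivalent X Y & c = sct Y].

Definition lscat (X : topologicalType) : \bar R :=
  ereal_inf [set n%:R%:E | n in
    [set n : nat | exists U : set (set X),
      [/\ forall A, U A -> open A /\ categorical A,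
          \bigcup_(A in U) A = [set: X] & (U #= `I_n)%card]]].

End Homotopy.

(* Main.v *)
Require Import Defs.
From HB Require Import structures.
From mathcomp Require Import all_boot all_order all_algebra.
From mathcomp Require Import all_classical all_reals all_analysis.
From mathcomp Require Import lra zify.

(** Only open covers of X matter.  Let f : X -> Y be a homotopy equivalence with
    homotopy inverse g, and let U_i, i in I, be a finite good cover of Y.  If f
    is nullhomotopic on an open subset V of X, then V is categorical in X,
    because the inclusion of V is homotopic to g o f and X, being connected and
    covered by contractible open sets, is path connected
    ([categorical_of_nullhomotopic], [connected_joined]).  Normality of X gives, by Urysohn's lemma,
    continuous functions phi_i >= 0 on X, never all zero at a point, such that
    f x lies in U_i whenever phi_i x > 0 ([normal_cover_functions]).  For a set
    J of indices let X_J be the open set where some phi_j with j in J is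
    positive.

    The count rests on two ways to cover X_J.  Let d be the largest size of a
    set s of indices in J for which the U_i with i in s have a common point.

    - X_J is covered by d categorical open sets ([dimension_cover]).  For s in J
      let W_s be the open set where every phi_i with i in s is positive and
      exceeds all phi_j with j in J outside s.  It is mapped by f into the
      contractible intersection of the U_i with i in s.  Two sets W_s and W_t
      that meet have s and t nested, so those with s of a given size are
      disjoint, and their union is categorical as X is path connected.

    - If the U_i with i in s have a common point p, then X_s is categorical
      ([star_categorical]), so X_J is covered by X_s and X_(J minus s).

    With s of size d, induction on the size of J covers X_J by m categorical
    open sets with m (m + 1) / 2 <= #|J|: either the induction already needs at
    least d sets for J minus s, and the d sets of the first kind suffice, or
    one adds X_s to fewer than d sets ([triangular_cover]).  For J = I this is
    the theorem.

    That X_s is categorical is usually read off from the nerve theorem. Here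
    it comes from [carried_homotopic]: two maps carried by the same sets are
    homotopic. Each of them is deformed along the contractions of the
    intersections, from the largest sets of indices to the smallest ones. On
    the part of W_t where the contraction for t is run to its end, the value
    of the map is replaced by a constant, and what happens afterwards depends
    only on that constant. For t ranging over the nonempty subsets of s, with
    W_t taken relative to J = s, these parts cover X_s, so the process turns
    both maps into the same map. It is applied to f and to the constant map p. *)

Set Implicit Arguments.
Unset Strict Implicit.
Unset Printing Implicit Defensive.

Import Order.TTheory GRing.Theory Num.Theory.
Import numFieldNormedType.Exports.

Local Open Scope classical_set_scope.
Local Open Scope ring_scope.

(** * Homotopies over open sets *)

(** Over an open set, continuity for the subspace topology is continuity at the
    points of the set, and letting the time range over all of R, with f before
    time 0 and g after time 1, makes concatenation and localization of
    homotopies pure matters of nearby equality. *)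
Definition homotopic_on (R : realType) (X Y : topologicalType)
    (A : set X) (B : set Y) (f g : X -> Y) : Prop :=
  exists H : R * X -> Y,
    [/\ forall t x, A x -> {for (t, x), continuous H},
        forall t x, A x -> B (H (t, x)),
        forall t x, A x -> t <= 0 -> H (t, x) = f x &
        forall t x, A x -> 1 <= t -> H (t, x) = g x].

Lemma near_continuous_at (X Y : topologicalType) (f g : X -> Y) (x : X) :
  (\forall y \near x, f y = g y) -> {for x, continuous g} ->
  {for x, continuous f}.
Proof.
move=> fg cg; have fgx : f x = g x by exact: nbhs_singleton fg.
rewrite /prop_for /continuous_at fgx; apply: cvg_trans cg.
by apply: near_eq_cvg; near=> y; apply/esym; near: y.
Unshelve. all: by end_near. Qed.

Lemma continuous_at_pair (X Y Z : topologicalType) (f : X -> Y) (g : X -> Z)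
    (x : X) :
  {for x, continuous f} -> {for x, continuous g} ->
  {for x, continuous (fun y => (f y, g y))}.
Proof. by move=> cf cg; exact: cvg_pair. Qed.

Lemma continuous_at_fst (X Y : topologicalType) (z : X * Y) :
  {for z, continuous (@fst X Y)}.
Proof. exact: cvg_fst. Qed.

Lemma continuous_at_snd (X Y : topologicalType) (z : X * Y) :
  {for z, continuous (@snd X Y)}.
Proof. exact: cvg_snd. Qed.

Lemma near_snd (X Y : topologicalType) (A : set Y) (z : X * Y) :
  open A -> A z.2 -> \forall w \near z, A w.2.
Proof.
move=> oA Az; apply: (@continuous_at_snd X Y z); exact: open_nbhs_nbhs.
Qed.

Section Homotopy.
Variable R : realType.

Lemma near_lt (X : topologicalType) (u : X -> R) (x : X) (a : R) :
  {for x, continuous u} -> u x < a -> \forall y \near x, u y < a.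
Proof.
move=> cu ua; apply: (cu [set r | r < a]); apply: open_nbhs_nbhs.
by split; first exact: open_lt.
Qed.

Lemma near_gt (X : topologicalType) (u : X -> R) (x : X) (a : R) :
  {for x, continuous u} -> a < u x -> \forall y \near x, a < u y.
Proof.
move=> cu ua; apply: (cu [set r | a < r]); apply: open_nbhs_nbhs.
by split; first exact: open_gt.
Qed.

Definition clamp (t : R) : R := Num.max 0 (Num.min t 1).

Lemma clamp_continuous : continuous clamp.
Proof.
move=> t; apply: (@continuous_comp _ _ _ (fun t : R => (0 : R, Num.min t 1))
  (fun z => Num.max z.1 z.2)); last exact: max_continuous.
apply: continuous_at_pair; first exact: cst_continuous.
apply: (@continuous_comp _ _ _ (fun t : R => (t, 1 : R))
  (fun z => Num.min z.1 z.2)); last exact: min_continuous.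
apply: continuous_at_pair; [exact: cvg_id|exact: cst_continuous].
Qed.

Lemma clamp_itv t : clamp t \in `[0, 1].
Proof.
by rewrite in_itv /= /clamp le_max lexx ge_max ler01 /= ge_min lexx orbT.
Qed.

Lemma clamp_le0 t : t <= 0 -> clamp t = 0.
Proof. by move=> t0; rewrite /clamp; apply/max_idPl; rewrite ge_min t0. Qed.

Lemma clamp_ge1 t : 1 <= t -> clamp t = 1.
Proof. by move=> t1; rewrite /clamp (min_idPr t1) (max_idPr ler01). Qed.

Lemma homotopic_on_of_within (X Y : topologicalType) (A : set X) (B : set Y)
    (f g : X -> Y) :
  open A -> homotopic_within R A B f g -> homotopic_on R A B f g.
Proof.
move=> oA [H [/subspace_continuousP cH HB H0 H1]].
exists (fun z => H (clamp z.1, z.2)); split => /=.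
- move=> t x Ax; have ct := clamp_itv t.
  rewrite /prop_for /continuous_at /=.
  have : (clamp z.1, z.2) @[z --> (t, x)] -->
      within (`[0, 1] `*` A) (nbhs (clamp t, x)).
    move=> P /=; rewrite /within /= => nP.
    have cc : {for (t, x), continuous (fun z : R * X => (clamp z.1, z.2))}.
      apply: continuous_at_pair; last exact: continuous_at_snd.
      apply: (@continuous_comp _ _ _ fst clamp); last exact: clamp_continuous.
      exact: continuous_at_fst.
    have near_A := near_snd (z := (t, x)) oA Ax.
    have near_P : \forall z \near (t, x), (`[0, 1] `*` A) (clamp z.1, z.2) ->
        P (clamp z.1, z.2) := cc _ nP.
    apply: filterS2 near_P near_A => z zP Az; apply: zP; split => //=.
    by have := clamp_itv z.1.
  move=> /cvg_comp; apply; apply: (cH (clamp t, x)).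
  by split.
- by move=> t x Ax; apply: HB => //; exact: clamp_itv.
- by move=> t x Ax t0; rewrite clamp_le0 // H0.
- by move=> t x Ax t0; rewrite clamp_ge1 // H1.
Unshelve. all: by end_near. Qed.

Lemma homotopic_within_of_on (X Y : topologicalType) (A : set X) (B : set Y)
    (f g : X -> Y) :
  homotopic_on R A B f g -> homotopic_within R A B f g.
Proof.
move=> [H [cH HB H0 H1]]; exists H; split.
- by apply: continuous_in_subspaceT => -[t x] /set_mem [_ Ax]; exact: cH.
- by move=> t x _; exact: HB.
- by move=> x Ax; exact: H0.
- by move=> x Ax; exact: H1.
Qed.

Lemma homotopic_on_eq (X Y : topologicalType) (A : set X) (B : set Y)
    (f g : X -> Y) :
  open A ->
  (forall x, A x -> {for x, continuous f}) -> (forall x, A x -> B (f x)) ->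
  (forall x, A x -> f x = g x) -> homotopic_on R A B f g.
Proof.
move=> oA cf fB fg; exists (f \o snd); split => //=.
- move=> t x Ax; apply: continuous_comp; first exact: continuous_at_snd.
  exact: cf.
- by move=> t x Ax _; exact: fg.
Qed.

Lemma homotopic_on_sym (X Y : topologicalType) (A : set X) (B : set Y)
    (f g : X -> Y) :
  homotopic_on R A B f g -> homotopic_on R A B g f.
Proof.
move=> [H [cH HB H0 H1]]; exists (fun z => H (1 - z.1, z.2)); split => /=.
- move=> t x Ax.
  apply: (@continuous_comp _ _ _ (fun z : R * X => (1 - z.1, z.2)) H);
    last exact: cH.
  apply: continuous_at_pair; last exact: continuous_at_snd.
  by apply: cvgB; [exact: cvg_cst|exact: continuous_at_fst].
- by move=> t x Ax; exact: HB.
- by move=> t x Ax t0; apply: H1 => //; lra.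
- by move=> t x Ax t0; apply: H0 => //; lra.
Qed.

Lemma homotopic_on_trans (X Y : topologicalType) (A : set X) (B : set Y)
    (g f h : X -> Y) : open A ->
  homotopic_on R A B f g -> homotopic_on R A B g h -> homotopic_on R A B f h.
Proof.
move=> oA [H [cH HB H0 H1]] [K [cK KB K0 K1]].
(* On the overlap 1/3 < t < 2/3 both branches are equal to g. *)
exists (fun z => if z.1 < 2^-1 then H (3 * z.1, z.2) else K (3 * z.1 - 2, z.2)).
split => /=.
- move=> t x Ax; have [t2|t2] := ltP t (2/3).
    have near_t := near_lt (@continuous_at_fst R X (t, x)) t2.
    apply: (@near_continuous_at _ _ _ (fun z : R * X => H (3 * z.1, z.2))).
      near=> z; have Az : A z.2 by near: z; exact: near_snd.
      have zt : z.1 < 2/3.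
        by near: z; exact: near_t.
      by case: ltP => // z2; rewrite K0 ?H1//; lra.
    apply: (@continuous_comp _ _ _ (fun z : R * X => (3 * z.1, z.2)) H);
      last exact: cH.
    apply: continuous_at_pair; last exact: continuous_at_snd.
    by apply: cvgM; [exact: cvg_cst|exact: continuous_at_fst].
  have t1 : 1 / 3 < t by lra.
  have near_t := near_gt (@continuous_at_fst R X (t, x)) t1.
  apply: (@near_continuous_at _ _ _ (fun z : R * X => K (3 * z.1 - 2, z.2))).
    near=> z; have Az : A z.2 by near: z; exact: near_snd.
    have zt : 1/3 < z.1.
      by near: z; exact: near_t.
    by case: ltP => // z2; rewrite K0 ?H1//; lra.
  apply: (@continuous_comp _ _ _ (fun z : R * X => (3 * z.1 - 2, z.2)) K);
    last exact: cK.
  apply: continuous_at_pair; last exact: continuous_at_snd.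
  apply: cvgB; last exact: cvg_cst.
  by apply: cvgM; [exact: cvg_cst|exact: continuous_at_fst].
- by move=> t x Ax; case: ifP => _; [exact: HB|exact: KB].
- by move=> t x Ax t0; case: ltP => ?; [rewrite H0//; lra|exfalso; lra].
- by move=> t x Ax t0; case: ltP => ?; [exfalso; lra|rewrite K1//; lra].
Unshelve. all: by end_near. Qed.

Lemma homotopic_on_sub (X Y : topologicalType) (A A' : set X) (B B' : set Y)
    (f g : X -> Y) : A' `<=` A -> B `<=` B' ->
  homotopic_on R A B f g -> homotopic_on R A' B' f g.
Proof.
move=> AA BB [H [cH HB H0 H1]]; exists H; split.
- by move=> t x /AA; exact: cH.
- by move=> t x /AA; move/HB => /(_ t)/BB.
- by move=> t x /AA; exact: H0.
- by move=> t x /AA; exact: H1.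
Qed.

Lemma homotopic_on_post (X Y Z : topologicalType) (A : set X) (B : set Y)
    (f g : X -> Y) (k : Y -> Z) : continuous k ->
  homotopic_on R A B f g -> homotopic_on R A setT (k \o f) (k \o g).
Proof.
move=> ck [H [cH HB H0 H1]]; exists (k \o H); split => //=.
- by move=> t x Ax; apply: continuous_comp; [exact: cH|exact: ck].
- by move=> t x Ax t0; rewrite H0.
- by move=> t x Ax t0; rewrite H1.
Qed.

Lemma homotopic_on_pre (W X Y : topologicalType) (A : set X) (B : set Y)
    (f g : X -> Y) (k : W -> X) : continuous k ->
  homotopic_on R A B f g -> homotopic_on R (k @^-1` A) B (f \o k) (g \o k).
Proof.
move=> ck [H [cH HB H0 H1]].
exists (fun z => H (z.1, k z.2)); split => /=.
- move=> t x Ax.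
  apply: (@continuous_comp _ _ _ (fun z : R * W => (z.1, k z.2)) H);
    last exact: cH.
  apply: continuous_at_pair; first exact: continuous_at_fst.
  by apply: continuous_comp; [exact: continuous_at_snd|exact: ck].
- by move=> t x Ax; exact: HB.
- by move=> t x Ax; exact: H0.
- by move=> t x Ax; exact: H1.
Qed.

Lemma homotopic_on_continuousr (X Y : topologicalType) (A : set X) (B : set Y)
    (f g : X -> Y) : open A -> homotopic_on R A B f g ->
  forall x, A x -> {for x, continuous g}.
Proof.
move=> oA [H [cH HB H0 H1]] x Ax.
apply: (@near_continuous_at _ _ _ (fun x => H (1 : R, x))).
  near=> y; rewrite H1//; near: y; exact: open_nbhs_nbhs.
apply: (@continuous_comp X (R * X)%type Y (fun x : X => (1 : R, x)) H);
  last exact: cH.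
by apply: continuous_at_pair; [exact: cst_continuous|exact: cvg_id].
Unshelve. all: by end_near. Qed.

(** * Carried maps *)

(** The time of the contraction c is governed by lam: it starts where lam = 1
    and has run its course where lam >= 2.  The band 0 < lam < 1, where f is
    already in C but c has not started, is what makes the two branches agree
    near the boundary of the support. *)
Lemma deform_on_support (X Y : topologicalType) (A : set X) (C : set Y)
    (lam : X -> R) (f : X -> Y) (c : R * Y -> Y) :
  open A -> (forall x, A x -> {for x, continuous lam}) ->
  (forall x, A x -> {for x, continuous f}) ->
  (forall t y, C y -> {for (t, y), continuous c}) ->
  (forall t y, C y -> t <= 0 -> c (t, y) = y) ->
  (forall x, A x -> 0 < lam x -> C (f x)) ->
  homotopic_on R A setT f
    (fun x => if 0 < lam x then c (lam x - 1, f x) else f x).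
Proof.
move=> oA clam cf cc c0 fC.
exists (fun z => if 0 < lam z.2
  then c (clamp z.1 * lam z.2 - clamp z.1, f z.2) else f z.2).
split => //=.
- move=> t x Ax.
  have cl : {for (t, x), continuous (fun z : R * X => lam z.2)}.
    by apply: continuous_comp; [exact: continuous_at_snd|exact: clam].
  have cf' : {for (t, x), continuous (fun z : R * X => f z.2)}.
    by apply: continuous_comp; [exact: continuous_at_snd|exact: cf].
  have [l1|l0] := ltP (lam x) 1; last first.
    apply: (@near_continuous_at _ _ _ (fun z : R * X =>
      c (clamp z.1 * lam z.2 - clamp z.1, f z.2))).
      near=> z; suff -> : 0 < lam z.2 by [].
      by near: z; apply: (near_gt cl) => /=; lra.
    apply: (@continuous_comp _ _ _ (fun z : R * X =>
      (clamp z.1 * lam z.2 - clamp z.1, f z.2)) c); last first.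
      by apply: cc; apply: fC => //; lra.
    apply: continuous_at_pair => //.
    have ccl : {for (t, x), continuous (fun z : R * X => clamp z.1)}.
      apply: (@continuous_comp _ _ _ fst clamp); last exact: clamp_continuous.
      exact: continuous_at_fst.
    by apply: cvgB => //; exact: cvgM.
  apply: (@near_continuous_at _ _ _ (fun z : R * X => f z.2)) => //.
  near=> z; have Az : A z.2 by near: z; exact: near_snd.
  have lz : lam z.2 < 1 by near: z; exact: (near_lt cl).
  case: ifP => // lz0; rewrite c0//; first exact: fC.
  have := clamp_itv z.1; rewrite in_itv/= => /andP[? _].
  by rewrite -[X in _ - X]mulr1 -mulrBr mulr_ge0_le0// subr_le0 ltW.
- move=> t x Ax t0; case: ifP => // lx; rewrite clamp_le0// mul0r subr0 c0//.
  exact: fC.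
- by move=> t x Ax t0; rewrite clamp_ge1// mul1r.
Unshelve. all: by end_near. Qed.

(** Both maps are pushed along the contraction of C s, one s of L at a time.
    The order of L guarantees that a push inside C s does not leave a set C t
    that is still to come.  At a point where lam s >= 2 the push makes the two
    maps equal, and equal values stay equal. *)
Lemma carried_homotopic (X Y : topologicalType) (A : set X) (T : eqType)
    (L : seq T) (lam : T -> X -> R) (C : T -> set Y) (f h : X -> Y) :
  open A ->
  (forall s x, A x -> {for x, continuous (lam s)}) ->
  (forall s, s \in L -> exists p, homotopic_on R (C s) (C s) id (cst p)) ->
  pairwise (fun s t => `[< forall x, A x -> 0 < lam s x -> 0 < lam t x ->
                           C s `<=` C t >]) L ->
  (forall x, A x -> {for x, continuous f}) ->
  (forall x, A x -> {for x, continuous h}) ->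
  (forall s x, s \in L -> A x -> 0 < lam s x -> C s (f x) /\ C s (h x)) ->
  (forall x, A x -> f x = h x \/ exists2 s, s \in L & 2 <= lam s x) ->
  homotopic_on R A setT f h.
Proof.
move=> oA clam; elim: L f h => [|s L IH] f h contr pw cf ch car cov.
  apply: homotopic_on_eq => // x Ax; by case: (cov x Ax) => // -[].
have [p [c [cc cC c0 c1]]] := contr s (mem_head _ _).
move: pw; rewrite pairwise_cons => /andP[/allP sL pwL].
have fs x : A x -> 0 < lam s x -> C s (f x).
  by move=> Ax /(car s x (mem_head _ _) Ax)[].
have hs x : A x -> 0 < lam s x -> C s (h x).
  by move=> Ax /(car s x (mem_head _ _) Ax)[].
pose push g x := if 0 < lam s x then c (lam s x - 1, g x) else g x.
have hf := deform_on_support oA (clam s) cf cc c0 fs.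
have hh := deform_on_support oA (clam s) ch cc c0 hs.
apply: (homotopic_on_trans oA hf); apply: homotopic_on_sym.
apply: (homotopic_on_trans oA hh); apply: homotopic_on_sym.
apply: (IH (push f) (push h)).
- by move=> t tL; apply: contr; rewrite in_cons tL orbT.
- exact: pwL.
- exact: homotopic_on_continuousr hf.
- exact: homotopic_on_continuousr hh.
- move=> t x tL Ax lt.
  have [ftx htx] := car t x (mem_behead (tL : t \in behead (s :: L))) Ax lt.
  rewrite /push; case: ifP => // ls.
  have /asboolP/(_ x Ax ls lt) sub := sL _ tL.
  by split; apply: sub; apply: cC; [exact: fs|exact: hs].
- move=> x Ax; have [e|[t]] := cov x Ax; first by left; rewrite /push e.
  rewrite in_cons => /orP[/eqP -> l2|tL l2]; last by right; exists t.
  have ls0 : 0 < lam s x by lra.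
  have l1 : 1 <= lam s x - 1 by lra.
  left; rewrite /push ls0.
  by rewrite (c1 _ _ (fs x Ax ls0) l1) (c1 _ _ (hs x Ax ls0) l1).
Qed.

End Homotopy.

(** * Gluing, paths and Urysohn functions *)

Section Cover.
Variable R : realType.

Lemma homotopic_on_bigcup (X Y : topologicalType) (I : finType) (P : pred I)
    (D : I -> set X) (B : set Y) (f g : X -> Y) :
  (forall i, P i -> open (D i)) ->
  (forall i j x, P i -> P j -> D i x -> D j x -> i = j) ->
  (forall i, P i -> homotopic_on R (D i) B f g) ->
  homotopic_on R (\bigcup_(i in [set i | P i]) D i) B f g.
Proof.
move=> oD disj hD.
have /choice[H HP] : forall i, exists H : R * X -> Y, P i ->
    [/\ forall t x, D i x -> {for (t, x), continuous H},
        forall t x, D i x -> B (H (t, x)),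
        forall t x, D i x -> t <= 0 -> H (t, x) = f x &
        forall t x, D i x -> 1 <= t -> H (t, x) = g x].
  move=> i; case: (boolP (P i)) => [/hD[H ?]|_]; first by exists H.
  by exists (f \o snd).
pose K (z : R * X) := if [pick i | P i && `[< D i z.2 >]] is Some i then H i z
  else f z.2.
have KE i z : P i -> D i z.2 -> K z = H i z.
  move=> Pi Di; rewrite /K; case: pickP => [j /andP[Pj /asboolP Dj]|/(_ i)].
    by rewrite (disj j i z.2).
  by rewrite Pi; case: asboolP.
exists K; split => [t x|t x|t x|t x] [i Pi Dx].
- have [cH _ _ _] := HP i Pi.
  apply: (@near_continuous_at _ _ _ (H i)); last exact: cH.
  by apply: filterS (near_snd (z := (t, x)) (oD i Pi) Dx) => z; exact: KE.
- by have [_ HB _ _] := HP i Pi; rewrite (KE i)//; exact: HB.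
- by have [_ _ H0 _] := HP i Pi; rewrite (KE i)//; exact: H0.
- by have [_ _ _ H1] := HP i Pi; rewrite (KE i)//; exact: H1.
Qed.

(** A path from x to y is a homotopy between the constant maps x and y. *)
Lemma connected_joined (X : topologicalType) :
  connected [set: X] ->
  (forall x : X, exists A, [/\ open A, A x &
     exists p, homotopic_on R A [set: X] id (cst p)]) ->
  forall x y : X, homotopic_on R [set: X] [set: X] (cst x) (cst y).
Proof.
move=> conn loc x.
pose S := [set y | homotopic_on R [set: X] [set: X] (cst x) (cst y)].
have tr a b c : homotopic_on R [set: X] [set: X] (cst a) (cst b) ->
    homotopic_on R [set: X] [set: X] (cst b) (cst c) ->
    homotopic_on R [set: X] [set: X] (cst a) (cst c).
  exact: (homotopic_on_trans openT).
have near_joined y : exists A : set X, [/\ open A, A y & forall z, A z ->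
    homotopic_on R [set: X] [set: X] (cst y) (cst z)].
  have [A [oA Ay [p hp]]] := loc y; exists A; split => // z Az.
  have to_p a : A a -> homotopic_on R [set: X] [set: X] (cst a) (cst p).
    move=> Aa; have := homotopic_on_pre (@cst_continuous X X a) hp.
    by apply: homotopic_on_sub => // w _; exact: Aa.
  by apply: (tr _ p); [exact: to_p|apply/homotopic_on_sym; exact: to_p].
have opens (Q : set X) : (forall y z, Q y ->
    homotopic_on R [set: X] [set: X] (cst y) (cst z) -> Q z) -> open Q.
  move=> HQ; rewrite openE => y Qy; have [A [oA Ay Az]] := near_joined y.
  apply: (@filterS _ (nbhs y) _ A); last exact: open_nbhs_nbhs.
  by move=> z /Az; exact: HQ.
have oS : open S by apply: opens => y z; exact: tr.
have oCS : open (~` S).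
  apply: opens => y z nSy yz Sz; apply: nSy; apply: (tr _ z) => //.
  exact: homotopic_on_sym.
have ST : S = [set: X].
  apply: conn.
  - exists x; apply: homotopic_on_eq => //; first exact: openT.
    by move=> y _; exact: cst_continuous.
  - by exists S; rewrite ?setTI.
  - by exists S; rewrite ?setTI// -openC.
by move=> y; suff : S y by []; rewrite ST.
Qed.

(** By induction on s, removing its head i: the function u for i only has to be
    positive on the part E of C that the other sets miss, and these other sets
    cover the closed subset of C where u vanishes. *)
Lemma normal_cover_functions (X : topologicalType) (I : eqType) (s : seq I)
    (V : I -> set X) (C : set X) :
  normal_space X -> (forall i, open (V i)) -> closed C ->
  (forall x, C x -> exists2 i, i \in s & V i x) ->
  exists phi : I -> X -> R,
    [/\ forall i, continuous (phi i), forall i x, 0 <= phi i x,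
        forall i x, 0 < phi i x -> V i x &
        forall x, C x -> exists2 i, i \in s & 0 < phi i x].
Proof.
move=> nX oV; elim: s C => [|i s IH] C cC sub.
  exists (fun _ _ => 0); split => //.
  - by move=> i; exact: cst_continuous.
  - by move=> i x; rewrite ltxx.
  - by move=> x /sub[].
pose E := C `&` ~` \bigcup_(j in [set` s]) V j.
have cE : closed E.
  apply: closedI => //; apply: open_closedC; exact: bigcup_open.
have cV : closed (~` V i) by exact: open_closedC.
have VE : ~` V i `&` E = set0.
  rewrite -subset0 => x [nV [/sub[j]]]; rewrite in_cons => /orP[/eqP ->//|js Vj].
  by apply; exists j.
have /(@uniform_separatorP _ R)[u [cu u01 uV uE]] :=
  (@normal_separatorP R X).1 nX _ _ cV cE VE.
have u_ge0 x : 0 <= u x.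
  have /= : `[0, 1]%classic (u x) by apply: u01; exists x.
  by rewrite in_itv/= => /andP[].
have [|x [Cx ux0]|phi [cphi phi0 phiV phiC]] := IH (C `&` u @^-1` [set 0]).
- apply: closedI => //; exact: closed_comp.
- have [j] := sub x Cx; rewrite in_cons => /orP[/eqP ->{j} Vx|js Vx];
    last by exists j.
  apply: contrapT => nx; have : [set u x | x in E] (u x).
    by exists x => //; split => // -[j js Vj]; apply: nx; exists j.
  by move=> /uE /=; rewrite ux0 => /esym/eqP; rewrite oner_eq0.
exists (fun j x => phi j x + (j == i)%:R * u x); split.
- move=> j x; apply: cvgD; first exact: cphi.
  by apply: cvgM; [exact: cvg_cst|exact: cu].
- by move=> j x; rewrite addr_ge0// mulr_ge0.
- move=> j x; have [->|_] := eqVneq j i; last first.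
    by rewrite mul0r addr0; exact: phiV.
  rewrite mul1r => lt0; apply: contrapT => nVx.
  have ux : u x = 0 by apply: uV; exists x.
  by apply: nVx; apply: phiV; rewrite ux addr0 in lt0.
- move=> x Cx; have [ux|ux] := eqVneq (u x) 0.
    have [//|j js pj] := phiC x; exists j; first by rewrite in_cons js orbT.
    by rewrite ux mulr0 addr0.
  exists i; first exact: mem_head.
  by rewrite eqxx mul1r ltr_wpDl// lt_def ux u_ge0.
Qed.

End Cover.

(** * The regions W_s of a family of functions *)

Section Gap.
Variables (R : realType) (X : topologicalType) (I : finType).
Variable phi : I -> X -> R.
Hypothesis phi_continuous : forall i, continuous (phi i).
Hypothesis phi_ge0 : forall i x, 0 <= phi i x.

(** A continuous function that is positive exactly on the region W_s.  Without
    the truncation at 0, several negative differences could have a positive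
    product. *)
Definition gap (J s : {set I}) (x : X) : R :=
  \prod_(i in s) (phi i x * \prod_(j in J :\: s) Num.max 0 (phi i x - phi j x)).

Implicit Types J s t : {set I}.

Lemma gap_continuous J s : continuous (gap J s).
Proof.
rewrite /gap; apply: (@continuous_big R^o I *%R 1 (mem s)) => [|i _].
  exact: mul_continuous.
move=> x; apply: cvgM; first exact: phi_continuous.
apply: (@continuous_big R^o I *%R 1 (mem (J :\: s)) _ X (index_enum I)
  (fun j x => Num.max 0 (phi i x - phi j x))) => [|j _ {}x].
  exact: mul_continuous.
apply: (@continuous_comp _ _ _
  (fun x => (0 : R, phi i x - phi j x)) (fun z => Num.max z.1 z.2));
  last exact: max_continuous.
apply: continuous_at_pair; first exact: cst_continuous.
by apply: cvgB; exact: phi_continuous.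
Qed.

Lemma gap_gt0P J s x : reflect
  (forall i, i \in s -> 0 < phi i x /\
     forall j, j \in J :\: s -> phi j x < phi i x)
  (0 < gap J s x).
Proof.
apply: (iffP idP) => [gap0 i si|H].
  have : gap J s x != 0 by rewrite gt_eqF.
  move=> /prodf_neq0 /(_ i si); rewrite mulf_eq0 negb_or => /andP[pi0].
  move=> /prodf_neq0 pj; split; first by rewrite lt_def pi0 phi_ge0.
  by move=> j /pj; rewrite -subr_gt0; case: leP => [|//]; rewrite eqxx.
apply: prodr_gt0 => i /H[pi0 pj]; apply: mulr_gt0 => //.
by apply: prodr_gt0 => j /pj; rewrite lt_max subr_gt0 => ->; rewrite orbT.
Qed.

(** Otherwise there are i in s outside t and j in t outside s, and both of phi_i
    and phi_j would be larger than the other. *)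
Lemma gap_nested J s t x : s \subset J -> t \subset J ->
  0 < gap J s x -> 0 < gap J t x -> (#|t| <= #|s|)%N -> t \subset s.
Proof.
move=> /fintype.subsetP sJ /fintype.subsetP tJ /gap_gt0P gs /gap_gt0P gt ts.
apply/fintype.subsetPn => -[j tj sj].
have /fintype.subsetPn[i si ti] : ~~ (s \subset t).
  apply/negP => st; have /eqP e : s == t by rewrite eqEcard st ts.
  by rewrite e tj in sj.
have [_ /(_ j)] := gs i si; rewrite inE sj tJ// => /(_ isT) ji.
have [_ /(_ i)] := gt j tj; rewrite inE ti sJ// => /(_ isT) ij.
by have := lt_trans ij ji; rewrite ltxx.
Qed.

Lemma gap_support J x : 0 < gap J [set i in J | 0 < phi i x]%SET x.
Proof.
apply/gap_gt0P => i; rewrite inE => /andP[_ pi0]; split => // j.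
rewrite !inE => /andP[+ jJ]; rewrite jJ /= -leNgt => pj.
exact: le_lt_trans pi0.
Qed.

End Gap.

(** * Counting categorical sets *)

Section Counting.
Variables (R : realType) (X Y : topologicalType) (f : X -> Y) (g : Y -> X).
Variables (I : finType) (U : I -> set Y) (phi : I -> X -> R).
Hypothesis f_continuous : continuous f.
Hypothesis g_continuous : continuous g.
Hypothesis gfE : homotopic_on R [set: X] [set: X] (g \o f) id.
Hypothesis X_joined :
  forall x y : X, homotopic_on R [set: X] [set: X] (cst x) (cst y).
Hypothesis phi_continuous : forall i, continuous (phi i).
Hypothesis phi_ge0 : forall i x, 0 <= phi i x.
Hypothesis phi_gt0 : forall i x, 0 < phi i x -> U i (f x).
Hypothesis U_neq0 : forall i, U i !=set0.

Definition meet (s : {set I}) : set Y := [set y | forall i, i \in s -> U i y].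

Hypothesis U_good : forall s : {set I}, s != finset.set0 -> meet s !=set0 ->
  exists p, homotopic_on R (meet s) (meet s) id (cst p).

Lemma categorical_of_nullhomotopic (V : set X) (p : Y) (x0 : X) : open V ->
  homotopic_on R V [set: Y] f (cst p) ->
  homotopic_on R V [set: X] id (cst x0).
Proof.
move=> oV /(homotopic_on_post g_continuous) hV.
apply: (homotopic_on_trans oV (g := g \o f)).
  by apply: homotopic_on_sym; exact: homotopic_on_sub gfE.
apply: (homotopic_on_trans oV hV).
by apply: homotopic_on_sub (X_joined (g p) x0).
Qed.

Definition positive (J : {set I}) : set X :=
  \bigcup_(j in [set` J]) [set x | 0 < phi j x].

Lemma open_gt0 (u : X -> R) : continuous u -> open [set x | 0 < u x].
Proof.
move=> cu; apply: (@open_comp X R u [set r | 0 < r]); last exact: open_gt.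
by move=> x _; exact: cu.
Qed.

Lemma positive_open J : open (positive J).
Proof. by apply: bigcup_open => j _; exact: open_gt0. Qed.

(** The map f and the constant map p are both carried by the sets meet s, for s
    a nonempty subset of J. *)
Lemma star_categorical (J : {set I}) (x0 : X) : meet J !=set0 ->
  homotopic_on R (positive J) [set: X] id (cst x0).
Proof.
move=> [p Jp]; apply: (@categorical_of_nullhomotopic _ p) => //.
  exact: positive_open.
pose P := [pred s : {set I} | (s \subset J) && (s != finset.set0)].
pose G x := \big[Num.max/0]_(s | P s) gap phi J s x.
have cG : continuous G.
  apply: continuous_big => [|s _]; first exact: max_continuous.
  exact: gap_continuous.
have G_gt0 x : positive J x -> 0 < G x.
  move=> [j /= jJ pj]; apply: lt_le_trans (gap_support phi_ge0 J x) _.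
  apply: (le_bigmax_cond _ (fun s => gap phi J s x)).
  rewrite /P /= setIdE finset.subsetIl /=; apply/set0Pn; exists j.
  by rewrite !inE jJ.
(* With this scaling lam s x = 2 for the s whose gap at x is largest. *)
pose lam s x := 2 * gap phi J s x / G x.
have lamP s x : positive J x -> (0 < lam s x) = (0 < gap phi J s x).
  by move=> /G_gt0 Gx; rewrite /lam pmulr_lgt0 ?invr_gt0// pmulr_rgt0.
have meet_sub (s t : {set I}) : t \subset s -> meet s `<=` meet t.
  by move=> /fintype.subsetP ts y sy i /ts; exact: sy.
pose r (s t : {set I}) := (#|t| <= #|s|)%N.
apply: (@carried_homotopic _ _ _ _ {set I} (sort r (enum P)) lam meet).
- exact: positive_open.
- move=> s x /G_gt0 Gx; apply: cvgM;
    last by apply: cvgV; [rewrite gt_eqF|exact: cG].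
  by apply: cvgM; [exact: cvg_cst|exact: gap_continuous].
- move=> s; rewrite mem_sort mem_enum => /andP[sJ s0].
  by apply: U_good => //; exists p; exact: meet_sub Jp.
- have : pairwise r (sort r (enum P)).
    rewrite -sorted_pairwise;
      last by move=> a b c; rewrite /r => /[swap]; exact: leq_trans.
    by apply: sort_sorted => s t; rewrite /r leq_total.
  apply: (@sub_in_pairwise _ [in sort r (enum P)]); last exact/allP.
  move=> s t.
  rewrite !mem_sort !mem_enum => /andP[sJ _] /andP[tJ _].
  move=> rst; apply/asboolP => x Ax; rewrite !lamP// => gs gt.
  apply: meet_sub; exact: gap_nested gs gt rst.
- by move=> x _; exact: f_continuous.
- by move=> x _; exact: cst_continuous.
- move=> s x; rewrite mem_sort mem_enum => /andP[/fintype.subsetP sJ _] Ax.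
  rewrite lamP// => /(gap_gt0P phi_ge0) gs; split => i si.
    by apply: phi_gt0; have [] := gs i si.
  by apply: Jp; exact: sJ.
- move=> x /G_gt0 Gx; right.
  have /bigmax_geP[|[s Ps Gs]] := lexx (G x); first by rewrite leNgt Gx.
  exists s; first by rewrite mem_sort mem_enum.
  by rewrite /lam -mulrA ler_peMr// ler_pdivlMr// mul1r.
Qed.

(** W k is the disjoint union of the regions of those sets s of size k + 1 whose
    U_i have a common point.  A point x of positive J lies in the region of the
    set of all j in J with phi j x > 0. *)
Lemma dimension_cover (J : {set I}) (d : nat) :
  (forall s : {set I}, s \subset J -> meet s !=set0 -> (#|s| <= d)%N) ->
  exists W : nat -> set X,
    [/\ forall k, (k < d)%N -> open (W k),
        forall k x0, (k < d)%N -> homotopic_on R (W k) [set: X] id (cst x0) &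
        forall x, positive J x -> exists2 k, (k < d)%N & W k x].
Proof.
move=> dimJ.
pose P k := [pred s : {set I} |
  [&& s \subset J, #|s| == k.+1 & `[< meet s !=set0 >]]].
pose D (s : {set I}) := [set x | 0 < gap phi J s x].
have oD s : open (D s) by apply: open_gt0; exact: gap_continuous.
exists (fun k => \bigcup_(s in [set s | P k s]) D s); split => [k _|k x0 _|x].
- by apply: bigcup_open => s _; exact: oD.
- apply: homotopic_on_bigcup => [s _|s t x|s]; first exact: oD.
    move=> /and3P[sJ /eqP sk _] /and3P[tJ /eqP tk _] Ds Dt.
    apply/eqP; rewrite finset.eqEsubset.
    by rewrite (gap_nested _ tJ sJ Dt Ds) ?(gap_nested _ sJ tJ Ds Dt)// sk tk.
  move=> /and3P[sJ /eqP sk /asboolP s0].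
  have [|p hp] := U_good _ s0; first by rewrite -card_gt0 sk.
  apply: (@categorical_of_nullhomotopic _ p) => //.
  apply: homotopic_on_sub (homotopic_on_pre f_continuous hp) => // x.
  by move=> /(gap_gt0P phi_ge0) gs i si; apply: phi_gt0; have [] := gs i si.
- move=> [j /= jJ pj]; set s := [set i in J | 0 < phi i x]%SET.
  have sJ : s \subset J by rewrite /s setIdE finset.subsetIl.
  have s0 : meet s !=set0.
    by exists (f x) => i; rewrite inE => /andP[_]; exact: phi_gt0.
  have js : j \in s by rewrite inE jJ.
  have s_gt0 : (0 < #|s|)%N by apply/card_gt0P; exists j.
  exists #|s|.-1; first by rewrite prednK// dimJ.
  exists s; last exact: gap_support.
  by rewrite /= sJ prednK// eqxx; apply/asboolP.
Qed.

(** Strong induction on the size of J, removing from J a largest set s whose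
    members U_i have a common point.  The bound is that of the triangular number
    m (m + 1) / 2, doubled so as to stay in the natural numbers. *)
Lemma triangular_cover (J : {set I}) :
  exists (m : nat) (W : nat -> set X),
    [/\ (m * m.+1 <= 2 * #|J|)%N,
        forall k, (k < m)%N -> open (W k),
        forall k x0, (k < m)%N -> homotopic_on R (W k) [set: X] id (cst x0) &
        forall x, positive J x -> exists2 k, (k < m)%N & W k x].
Proof.
have [n] := ubnP #|J|; elim: n J => // n IH J Jn.
have [->|[j0 j0J]] := set_0Vmem J.
  by exists 0%N, (fun _ => set0); split => // x [j /=]; rewrite inE.
pose P := [pred s : {set I} | (s \subset J) && `[< meet s !=set0 >]].
have Pj0 : P [set j0]%SET.
  rewrite /P /= finset.sub1set j0J /=; apply/asboolP; have [y y0] := U_neq0 j0.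
  by exists y => i; rewrite inE => /eqP ->.
case: (@arg_maxnP _ [set j0]%SET P (fun s => #|s|) Pj0).
move=> s /andP[sJ /asboolP s0] smax.
have s_gt0 : (0 < #|s|)%N by have := smax _ Pj0; rewrite cards1.
have [|W1 [oW1 hW1 cW1]] := @dimension_cover J #|s|.
  by move=> t tJ t0; apply: smax; rewrite /= tJ; apply/asboolP.
have cardJ : #|J| = (#|s| + #|J :\: s|)%N.
  by rewrite -(cardsID s J) (finset.setIidPr sJ).
have [|m [W [le_m oW hW cW]]] := IH (J :\: s).
  by lia.
(* If d = #|s| <= m, then d (d + 1) <= 2 d + m (m + 1) <= 2 #|J|; if m < d, then
   (m + 1) (m + 2) <= 2 d + m (m + 1) <= 2 #|J|. *)
have [dm|md] := leqP #|s| m.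
  by exists #|s|, W1; split => //; nia.
exists m.+1, (fun k => if k == m then positive s else W k).
split => [|k|k x0|x].
- by nia.
- rewrite ltnS; case: eqVneq => [_ _|km kle]; first exact: positive_open.
  by apply: oW; lia.
- rewrite ltnS; case: eqVneq => [_ _|km kle]; first exact: star_categorical.
  by apply: hW; lia.
- move=> [j /= jJ pj]; have [js|js] := boolP (j \in s).
    by exists m; rewrite // eqxx; exists j.
  have [|k km Wk] := cW x; first by exists j => //=; rewrite inE js.
  by exists k; [lia|rewrite ltn_eqF].
Qed.

End Counting.

(** * The inequality *)

Lemma lscat_ge0 (R : realType) (X : topologicalType) : (0 <= lscat R X)%E.
Proof. by apply: le_ereal_inf_tmp => _ [n _ <-]; rewrite lee_fin ler0n. Qed.

(** The sets W k need not be distinct, so the set that they form may have fewer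
    than m elements. *)
Lemma lscat_le (R : realType) (X : topologicalType) (m : nat)
    (W : nat -> set X) :
  (forall k, (k < m)%N -> open (W k)) ->
  (forall k, (k < m)%N -> categorical R (W k)) ->
  (forall x, exists2 k, (k < m)%N & W k x) -> (lscat R X <= m%:R%:E)%E.
Proof.
move=> oW hW cW; pose V := W @` `I_m.
have /finite_setP[n Vn] : finite_set V by apply: finite_image; exact: finite_II.
have nm : (n <= m)%N.
  by rewrite -card_le_II -(card_le_eql Vn); exact: card_image_le.
apply: ge_ereal_inf; exists n%:R%:E; last by rewrite lee_fin ler_nat.
exists n => //; exists V; split => //.
- by move=> _ [k km <-]; split; [exact: oW|exact: hW].
- apply/seteqP; split => // x _; have [k km Wx] := cW x.
  by exists (W k) => //; exists k.
Qed.

Lemma lscat_triangular (R : realType) (X Y : topologicalType)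
    (f : X -> Y) (g : Y -> X) (n : nat) (U : set (set Y)) :
  normal_space X -> continuous f -> continuous g -> homotopic R (g \o f) id ->
  (forall x y : X, homotopic_on R [set: X] [set: X] (cst x) (cst y)) ->
  good_cover R U -> (U #= `I_n)%card ->
  exists2 m : nat, (lscat R X <= m%:R%:E)%E & (m * m.+1 <= 2 * n)%N.
Proof.
move=> nX cf cg gf joined [oU covU contrU meetU].
move=> /card_esym/card_set_bijP[F [FU _ Fsurj]].
have gf' : homotopic_on R [set: X] [set: X] (g \o f) id.
  by apply: homotopic_on_of_within => //; exact: openT.
pose Ui (i : 'I_n) := F i.
have UiU i : U (Ui i) by apply: FU => /=.
have [i|x _|phi [cphi phi0 phi_gt0 phi_cov]] :=
  @normal_cover_functions R X 'I_n (index_enum 'I_n) (fun i => f @^-1` Ui i)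
    setT nX _ closedT.
- by apply: open_comp => [x _|]; [exact: cf|apply: oU].
- have [V UV Vfx] : (\bigcup_(A in U) A) (f x) by rewrite covU.
  have [i /= ilt Fi] := Fsurj _ UV.
  by exists (Ordinal ilt); rewrite ?mem_index_enum//= /Ui /= Fi.
have U_neq0 i : Ui i !=set0.
  by have [y Uy _] := contrU _ (UiU i); exists y.
have meetE (s : {set 'I_n}) : meet Ui s = \bigcap_(A in Ui @` [set` s]) A.
  by rewrite bigcap_image.
have [|m [W [le_m oW hW cW]]] :=
    triangular_cover cf cg gf' joined cphi phi0 phi_gt0 U_neq0 _
      [set: 'I_n]%SET.
  move=> s /set0Pn[i si] s0.
  have [p mp hp] : contractible R (meet Ui s).
    rewrite meetE; apply: meetU.
    - by move=> _ [j _ <-].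
    - by exists (Ui i), i.
    - by apply: finite_image; exact: finite_finset.
    - by rewrite -meetE.
  exists p; apply: homotopic_on_of_within => //.
  rewrite openE => y sy.
  apply: (@filter_forall Y 'I_n (fun i z => i \in s -> Ui i z) (nbhs y)) => j.
  have [js|_] := boolP (j \in s); last exact: filterE.
  apply: filterS (open_nbhs_nbhs (conj (oU _ (UiU j)) (sy j js))) => z Uz _.
  exact: Uz.
exists m; last by move: le_m; rewrite cardsT card_ord.
apply: (lscat_le oW) => [k km|x].
  (* A base point of X comes from a point of some member of the cover of Y. *)
  have n_gt0 : (0 < n)%N by move: le_m; rewrite cardsT card_ord; nia.
  have [y _] := U_neq0 (Ordinal n_gt0).
  by exists (g y); apply: homotopic_within_of_on; exact: hW.
have [j _ pj] := phi_cov x Logic.I.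
by apply: cW; exists j => //=; rewrite inE.
Qed.

Theorem theorem2p2 (R : realType) (X : topologicalType)
    (X_connected : connected [set: X]) (X_normal : normal_space X)
    (X_cover : has_finite_good_cover R X) :
  (2^-1%:E * (lscat R X * (lscat R X + 1)) <= ct R X)%E.
Proof.
have joined : forall x y : X, homotopic_on R [set: X] [set: X] (cst x) (cst y).
  apply: connected_joined => // x.
  have [V _ [oV covV contrV _]] := X_cover.
  have [A VA Ax] : (\bigcup_(A in V) A) x by rewrite covV.
  exists A; split => //; first exact: oV.
  have [p Ap hp] := contrV _ VA; exists p.
  by apply: homotopic_on_sub (homotopic_on_of_within (oV _ VA) hp).
apply: le_ereal_inf_tmp => _ [Y [f [g [cf cg gf _]]] ->].
apply: le_ereal_inf_tmp => _ [n [U goodU cardU] <-].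
have [m le_m mn] := lscat_triangular X_normal cf cg gf joined goodU cardU.
move: le_m (lscat_ge0 R X); case: (lscat R X) => [r| |] //.
rewrite !lee_fin => rm r0.
have rm2 : r * (r + 1) <= m%:R * (m%:R + 1) by rewrite ler_pM ?lerD ?addr_ge0.
have mn2 : m%:R * (m%:R + 1) <= 2 * n%:R :> R.
  by rewrite natr1 -!natrM ler_nat.
lra.
Qed.
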